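(* There exists a constant $\epsilon_0>0$ such that for every constant $\epsilon\in(0,\epsilon_0]$ there exists a constant $\delta=\delta(\epsilon)>0$ for which the following holds. Let $d=d(n)$ be positive integers with $d=o(n)$ as $n\to\infty$, let $p=\frac{1+\epsilon}{d}$, and let $G$ be an $(n,d,\lambda)$-graph with $\frac{\lambda}{d}\le\delta$. Then, with probability tending to one as $n\to\infty$, $G_p$ contains an induced path of length at least $\frac{\epsilon^2 n}{3d}$.
   Context: Graphs are finite and simple. Given a $d$-regular graph $G$ on $n$ vertices, let $d=\lambda_1\ge \lambda_2\ge\cdots\ge\lambda_n$ be the eigenvalues of its adjacency matrix (with multiplicity) and let $\lambda=\max\{|\lambda_2|,|\lambda_n|\}$; then $G$ is called an $(n,d,\lambda)$-graph. The statement is asymptotic: one considers a sequence of pairs $(n_k,d_k)$ with $n_k\to\infty$ and $d_k=o(n_k)$, and a sequence of $(n_k,d_k,\lambda_k)$-graphs $G_k$ with $\lambda_k/d_k\le\delta$; the constants $\epsilon,\delta$ do not depend on $k$. For a graph $G=(V,E)$ and $p\in[0,1]$, $V_p$ denotes the random subset of $V$ obtained by retaining every $v\in V$ independently with probability $p$, and $G_p:=G[V_p]$ is the induced subgraph on $V_p$ (the $p$-site-percolated subgraph). An induced path of a graph is an induced subgraph that is a path. Rounding signs are ignored. *)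

(* Defs.v *)
From mathcomp Require Import all_boot all_order all_algebra.
From mathcomp Require Import boolp reals topology normedtype landau sequences.

Set Implicit Arguments.
Unset Strict Implicit.
Unset Printing Implicit Defensive.

Import Order.TTheory GRing.Theory Num.Theory.
Import numFieldNormedType.Exports.

Local Open Scope ring_scope.

Definition simple_graph (T : finType) (e : rel T) : Prop :=
  symmetric e /\ irreflexive e.

Definition regular (T : finType) (e : rel T) (d : nat) : Prop :=
  forall v, #|[set u | e v u]| = d.

Definition adjmx (R : nzRingType) (n : nat) (e : rel 'I_n) : 'M[R]_n :=
  \matrix_(i, j) (e i j)%:R.

(* The eigenvalues with their algebraic multiplicity (for a symmetric matrix,
   also the geometric one), in nonincreasing order: s`_i is the (i+1)-st. *)
Definition spectrum (R : realType) (n : nat) (A : 'M[R]_n) (s : seq R) : Prop :=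
  sorted (fun x y => y <= x) s /\ char_poly A = \prod_(x <- s) ('X - x%:P).

Definition ndl_graph (R : realType) (n d : nat) (lam : R) (e : rel 'I_n) : Prop :=
  [/\ simple_graph e, regular e d &
      exists2 s : seq R, spectrum (adjmx R e) s &
        lam = Num.max `|s`_1| `|s`_n.-1| ].

Definition induced (T : finType) (e : rel T) (S : {set T}) :
  rel {x : T | x \in S} := fun u v => e (val u) (val v).
Arguments induced {T} e S.

Definition graph_iso (T1 T2 : finType) (e1 : rel T1) (e2 : rel T2) : Prop :=
  exists2 f : T1 -> T2, bijective f & forall u v, e2 (f u) (f v) = e1 u v.

(* The path of length l: l edges, hence l.+1 vertices. *)
Definition path_graph (l : nat) : rel 'I_l.+1 :=
  fun i j => (j == i.+1 :> nat) || (i == j.+1 :> nat).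
Arguments path_graph l : clear implicits.

Definition has_induced_path (T : finType) (e : rel T) (l : nat) : Prop :=
  exists U : {set T}, graph_iso (path_graph l) (induced e U).

(* The probability that the random subset of T retaining each element
   independently with probability p satisfies E; meaningful for 0 <= p <= 1. *)
Definition site_prob (R : realType) (T : finType) (p : R)
    (E : {set T} -> Prop) : R :=
  \sum_(S : {set T} | `[< E S >]) (\prod_(v in S) p) * \prod_(v in ~: S) (1 - p).

(* Main.v *)
Require Import Defs.
From mathcomp Require Import all_boot all_order all_algebra all_fingroup.
From mathcomp Require Import complex boolp reals.
From mathcomp Require Import ring lra zify.

(** The idea is a depth-first search whose stack is an induced path, run on
    the random set S of retained vertices.

    Put N = n/d.  The search reveals vertices one at a time.  It only looks at
    unqueried neighbours of the top of the stack that are not adjacent to any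
    earlier stack vertex; a queried vertex that turns out to be in S is pushed,
    and the top is popped when it offers no vertex to query.  A pushed vertex
    is thus adjacent to the old top and to nothing else on the stack, so the
    stack is always an induced path.  The price is that neighbours of the stack
    may stay unqueried.  With Q the queried vertices, F those of them found in
    S and U the stack, the invariant is that all neighbours of F lie in Q or
    are neighbours of U ([search_tree]).  In a d-regular graph this gives
      |N(F)| <= |Q| + d |U|.

    The search is stopped when |F| reaches s, about eps N.  Two facts, each
    true with probability tending to one, then force U to be long.
    - The number |F| of successes among |Q| adaptive queries is close to
      p |Q|, hence |Q| is at most about d s / (1 + eps).  This follows from a
      second moment computation along the decision tree of the search
      ([discrepancy_second_moment]).
    - Every s-element subset A of S satisfies
      |N(A)| >= d (s - s^2 / (2 N) - small error).  For this, list the elements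
      of A: the next one, a, adds d vertices to the neighbourhood C of the
      previous ones, minus its degree into C, and this degree is about
      d |C| / n unless a is one of the few vertices that are irregular for C.
      The spectral gap makes the proportion of irregular vertices as small as
      we like, so that tuples in which a positive proportion of the entries
      are irregular are rare enough to beat the number e^(O(s)) of candidate
      sets ([prob_poorly_expanding]).  The hypothesis lambda / d <= delta
      enters through a second moment over the vertices
      ([ndl_degree_variance]).
    Together, |U| is at least about
      s - s^2 / (2 N) - s / (1 + eps), close to (eps^2 / 2) N when s = eps N,
    and 1/2 > 1/3 leaves room for all the errors ([path_length_bound]).

    All the estimates are explicit: the failure probability is at most a
    constant depending on eps times d/n ([prob_long_path]), which tends to zero
    since d = o(n). *)

Set Implicit Arguments.
Unset Strict Implicit.
Unset Printing Implicit Defensive.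

Import Order.TTheory GRing.Theory Num.Theory.
Local Open Scope ring_scope.

(** * Expectation over the random vertex set *)

Section SiteExpectation.
Variables (R : realType) (T : finType) (p : R).

Definition siteE (f : {set T} -> R) : R :=
  \sum_(S : {set T}) (\prod_(v in S) p) * (\prod_(v in ~: S) (1 - p)) * f S.

Lemma site_probE (E : {set T} -> Prop) :
  site_prob p E = siteE (fun S => `[< E S >]%:R).
Proof.
rewrite /site_prob /siteE big_mkcond; apply: eq_bigr => S _.
by case: `[< E S >]; rewrite ?mulr1 ?mulr0.
Qed.

Lemma siteED (f g : {set T} -> R) :
  siteE (fun S => f S + g S) = siteE f + siteE g.
Proof. by rewrite -big_split; apply: eq_bigr => S _; rewrite mulrDr. Qed.

Lemma siteEZ c (f : {set T} -> R) : siteE (fun S => c * f S) = c * siteE f.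
Proof. by rewrite mulr_sumr; apply: eq_bigr => S _; rewrite mulrCA. Qed.

Lemma siteE_sum (I : finType) (P : pred I) (f : I -> {set T} -> R) :
  siteE (fun S => \sum_(i | P i) f i S) = \sum_(i | P i) siteE (f i).
Proof.
by rewrite exchange_big; apply: eq_bigr => S _; rewrite mulr_sumr.
Qed.

Lemma siteE1 : siteE (fun=> 1) = 1.
Proof.
have := @bigA_distr R 0 1 *%R +%R T (fun=> p) (fun=> 1 - p).
rewrite (eq_bigr (fun=> 1)) => [|i _]; last by rewrite /= addrC subrK.
rewrite big1 // => one; rewrite [RHS]one; apply: eq_bigr => S _; rewrite mulr1.
rewrite [RHS](bigID (mem S)) /=; congr (_ * _).
  by apply: eq_bigr => v vS; rewrite ifT.
by apply: eq_big => [v|v]; rewrite inE // => /negPf ->.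
Qed.

(** Conditioning on whether v is retained: both conditional expectations are
    written as expectations over the unconditioned set, since forcing v in or
    out does not affect the other vertices. *)
Lemma siteE_cond (v : T) (f : {set T} -> R) :
  siteE f = p * siteE (fun S => f (v |: S)) + (1 - p) * siteE (fun S => f (S :\ v)).
Proof.
have split_v (g : {set T} -> R) : \sum_S g S =
    \sum_(S : {set T} | v \notin S) (g S + g (v |: S)).
  rewrite (bigID (fun S : {set T} => v \notin S)) big_split /=; congr (_ + _).
  rewrite (reindex_onto (fun S => v |: S) (fun S => S :\ v)) /=.
    apply: eq_bigl => S; rewrite setU11 /=; apply/eqP/idP => [<-|vS].
      by rewrite setD11.
    by rewrite setU1K.
  by move=> S; rewrite negbK => vS; rewrite setD1K.
have wU (S : {set T}) : v \notin S ->
  ((\prod_(i in v |: S) p) * (\prod_(i in ~: (v |: S)) (1 - p)) =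
    p * ((\prod_(i in S) p) * (\prod_(i in ~: S :\ v) (1 - p)))) *
  ((\prod_(i in S) p) * (\prod_(i in ~: S) (1 - p)) =
    (1 - p) * ((\prod_(i in S) p) * (\prod_(i in ~: S :\ v) (1 - p)))).
  move=> vS; rewrite big_setU1 //= setCU [~: [set v] :&: _]setIC -setDE mulrA; split=> //.
  by rewrite (big_setD1 (A := ~: S) v) ?inE //= mulrCA.
rewrite /siteE !split_v !mulr_sumr -big_split; apply: eq_bigr => S vS.
rewrite !(wU S vS).1 !(wU S vS).2 /= setUA setUid setU1K //.
have -> : S :\ v = S by apply/setDidPl; rewrite disjoint_sym disjoints1.
set g := \prod_(i in S) p * _; ring.
Qed.

Lemma siteE_subset (m : nat) (A : {set T}) : #|A| = m ->
  siteE (fun S => (A \subset S)%:R) = p ^+ m.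
Proof.
elim: m A => [|m IH] A cA.
  move/eqP: cA; rewrite cards_eq0 => /eqP ->; rewrite expr0 -[RHS]siteE1 /siteE.
  by apply: eq_bigr => S _; rewrite sub0set.
have /card_gt0P[v vA] : (0 < #|A|)%N by rewrite cA.
have cAv : #|A :\ v| = m by move: cA; rewrite (cardsD1 v) vA => -[].
rewrite (siteE_cond v) exprS -(IH _ cAv) [X in _ + _ * X](_ : _ = 0).
  rewrite mulr0 addr0; congr (_ * _); apply: eq_bigr => S _.
  by rewrite subDset.
rewrite /siteE big1 // => S _.
case: (boolP (A \subset _)) => [/subsetP/(_ v vA)|]; rewrite ?mulr0 //.
by rewrite setD11.
Qed.

Lemma site_prob_subset (A : {set T}) :
  site_prob p (fun S => A \subset S) = p ^+ #|A|.
Proof.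
rewrite site_probE -(siteE_subset erefl) /siteE; apply: eq_bigr => S _.
by rewrite asboolb.
Qed.

Lemma site_probC (E : {set T} -> Prop) :
  site_prob p E = 1 - site_prob p (fun S => ~ E S).
Proof.
apply/eqP; rewrite eq_sym subr_eq !site_probE -siteED -[eqbLHS]siteE1; apply/eqP.
apply: eq_bigr => S _; rewrite asbool_neg.
by case: `[< E S >]; rewrite ?addr0 ?add0r.
Qed.

Hypothesis p01 : 0 <= p <= 1.

Lemma site_weight_ge0 (S : {set T}) :
  0 <= (\prod_(v in S) p) * (\prod_(v in ~: S) (1 - p)).
Proof.
case/andP: p01 => p0 p1.
by apply: mulr_ge0; apply: prodr_ge0 => v _; rewrite ?subr_ge0.
Qed.

Lemma siteE_le (f g : {set T} -> R) :
  (forall S, f S <= g S) -> siteE f <= siteE g.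
Proof.
by move=> fg; apply: ler_sum => S _; apply: ler_wpM2l (fg S); apply: site_weight_ge0.
Qed.

Lemma site_prob_ge0 (E : {set T} -> Prop) : 0 <= site_prob p E.
Proof. by apply: sumr_ge0 => S _; apply: site_weight_ge0. Qed.

Lemma site_prob_le (E F : {set T} -> Prop) : (forall S, E S -> F S) ->
  site_prob p E <= site_prob p F.
Proof.
move=> EF; rewrite !site_probE; apply: siteE_le => S.
by case: asboolP => // /EF FS; rewrite asboolT.
Qed.

Lemma site_prob_le1 (E : {set T} -> Prop) : site_prob p E <= 1 :> R.
Proof.
rewrite site_probE -[leRHS]siteE1; apply: siteE_le => S.
by case: `[< _ >].
Qed.

Lemma site_probU (E F : {set T} -> Prop) :
  site_prob p (fun S => E S \/ F S) <= site_prob p E + site_prob p F.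
Proof.
rewrite !site_probE -siteED; apply: siteE_le => S.
rewrite asbool_or; by case: `[< E S >]; case: `[< F S >]; rewrite -natrD ler_nat.
Qed.

Lemma site_prob_exists (I : finType) (P : pred I) (E : I -> {set T} -> Prop) :
  site_prob p (fun S => exists2 i, P i & E i S) <= \sum_(i | P i) site_prob p (E i).
Proof.
rewrite (eq_bigr (fun i => siteE (fun S => `[< E i S >]%:R))); last first.
  by move=> i _; rewrite site_probE.
rewrite site_probE -siteE_sum; apply: siteE_le => S.
case: asboolP => [[i Pi Ei]|_]; last exact: sumr_ge0.
by rewrite (bigD1 i) //= asboolT // lerDl sumr_ge0.
Qed.

End SiteExpectation.

(** * Adaptive queries *)

Section DecisionTree.
Variable T : finType.

(** An adaptive exploration of the random set: [Ask v no yes] queries v, then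
    goes on with [no] or [yes] according to the answer. *)
Inductive dtree := Stop | Ask of T & dtree & dtree.

Fixpoint queried (t : dtree) (S : {set T}) : {set T} :=
  if t is Ask v no yes then v |: queried (if v \in S then yes else no) S
  else set0.

(** No branch of the tree queries a vertex of Q, or a vertex twice; the latter
    is what makes successive answers independent. *)
Fixpoint avoids (Q : {set T}) (t : dtree) : bool :=
  if t is Ask v no yes then
    [&& v \notin Q, avoids (v |: Q) no & avoids (v |: Q) yes]
  else true.

Lemma avoidsW (Q Q' : {set T}) t : Q \subset Q' -> avoids Q' t -> avoids Q t.
Proof.
elim: t Q Q' => //= v no IHn yes IHy Q Q' sQ /and3P[vQ an ay].
by rewrite (contra (subsetP sQ v) vQ) (IHn _ _ _ an) ?(IHy _ _ _ ay) // setUS.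
Qed.

Lemma queried_avoids Q t S w : avoids Q t -> w \in queried t S -> w \notin Q.
Proof.
elim: t Q => [|v no IHn yes IHy] Q /=; first by rewrite inE.
case/and3P=> vQ an ay; rewrite !inE => /orP[/eqP -> //|wq].
suff : w \notin v |: Q by rewrite !inE negb_or => /andP[].
by move: wq; case: ifP => _; [apply: IHy|apply: IHn].
Qed.

Lemma queried_local (Q : {set T}) t (S S' : {set T}) : avoids Q t ->
  (forall v, v \notin Q -> (v \in S) = (v \in S')) -> queried t S = queried t S'.
Proof.
move=> + SS'; elim: t => //= v no IHn yes IHy /and3P[vQ an ay].
have sQ : Q \subset v |: Q by apply: subsetUr.
by rewrite SS' //; case: ifP => _; rewrite ?IHn ?IHy //; apply: avoidsW sQ _.
Qed.

End DecisionTree.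

Section Discrepancy.
Variables (R : realType) (T : finType) (p : R).

(** The value, at the end of the exploration, of a martingale: each query adds
    1 - p or - p according to the answer. *)
Definition discrepancy (t : dtree T) (S : {set T}) : R :=
  #|S :&: queried t S|%:R - p * #|queried t S|%:R.

Lemma discrepancy_local (Q : {set T}) t (S S' : {set T}) : avoids Q t ->
  (forall v, v \notin Q -> (v \in S) = (v \in S')) ->
  discrepancy t S = discrepancy t S'.
Proof.
move=> aQ SS'; rewrite /discrepancy (queried_local aQ SS'); congr (_%:R - _).
apply: eq_card => v; rewrite !inE.
case vq: (v \in queried t S'); rewrite ?andbF // !andbT; apply: SS'.
exact: queried_avoids aQ vq.
Qed.

Lemma discrepancy_ask v no yes S : avoids set0 (Ask v no yes) ->
  discrepancy (Ask v no yes) S =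
  if v \in S then 1 - p + discrepancy yes S else - p + discrepancy no S.
Proof.
rewrite /= => /and3P[_ an ay]; rewrite /discrepancy /=.
case vS: (v \in S).
  have vq : v \notin queried yes S.
    by apply/negP => /(queried_avoids ay); rewrite setU0 !inE eqxx.
  have -> : S :&: (v |: queried yes S) = v |: (S :&: queried yes S).
    by apply/setP => w; rewrite !inE; case: eqP => [->|]; rewrite ?vS.
  rewrite !cardsU1 vq inE (negPf vq) andbF /= !natrD; ring.
have vq : v \notin queried no S.
  by apply/negP => /(queried_avoids an); rewrite setU0 !inE eqxx.
have -> : S :&: (v |: queried no S) = S :&: queried no S.
  by apply/setP => w; rewrite !inE; case: eqP => [->|]; rewrite ?vS.
rewrite !cardsU1 vq /= !natrD; ring.
Qed.

(** The increments of the martingale are orthogonal, each of variance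
    p (1 - p), and there are at most as many as vertices left to query.  The
    offset a is the value reached before the part of the exploration described
    by t; it makes the induction on t possible. *)
Lemma discrepancy_second_moment (Q : {set T}) t a : 0 <= p <= 1 -> avoids Q t ->
  siteE p (fun S => (a + discrepancy t S) ^+ 2) <= a ^+ 2 + p * (1 - p) * #|~: Q|%:R.
Proof.
move=> p01; have /andP[p0 p1] := p01.
have pq0 : 0 <= p * (1 - p) by rewrite mulr_ge0 // subr_ge0.
elim: t Q a => [|v no IHn yes IHy] Q a aQ.
  rewrite (_ : siteE p _ = a ^+ 2 * siteE p (fun _ : {set T} => 1)).
    by rewrite siteE1 mulr1 lerDl mulr_ge0.
  rewrite -siteEZ /siteE; apply: eq_bigr => S _.
  by rewrite /discrepancy /= setI0 cards0 mulr0 subr0 addr0 mulr1.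
have a0 : avoids set0 (Ask v no yes) by apply: avoidsW aQ; apply: sub0set.
have := aQ; rewrite /= => /and3P[vQ an ay].
have cQ : #|~: Q|%:R = 1 + #|~: (v |: Q)|%:R :> R.
  rewrite -[1]/(1%:R) -natrD; congr _%:R.
  rewrite (cardsD1 v) inE vQ setCU; congr (_ + _)%N; apply: eq_card => w.
  by rewrite !inE.
have sv : [set v]%SET \subset v |: Q by rewrite sub1set setU11.
rewrite (siteE_cond p v).
rewrite (_ : siteE p (fun S => (a + discrepancy _ (v |: S)) ^+ 2) =
             siteE p (fun S => (a + (1 - p) + discrepancy yes S) ^+ 2)); last first.
  rewrite /siteE; apply: eq_bigr => S _; congr (_ * _ ^+ 2).
  rewrite discrepancy_ask // setU11 addrA; congr (_ + _).
  apply: (discrepancy_local (avoidsW sv ay)) => w.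
  by rewrite !inE => /negPf ->.
rewrite (_ : siteE p (fun S => (a + discrepancy _ (S :\ v)) ^+ 2) =
             siteE p (fun S => (a - p + discrepancy no S) ^+ 2)); last first.
  rewrite /siteE; apply: eq_bigr => S _; congr (_ * _ ^+ 2).
  rewrite discrepancy_ask // setD11 addrA; congr (_ + _).
  apply: (discrepancy_local (avoidsW sv an)) => w.
  by rewrite !inE => /negPf ->.
have {}IHy := ler_wpM2l p0 (IHy _ (a + (1 - p)) ay).
have q0 : 0 <= 1 - p by rewrite subr_ge0.
have {}IHn := ler_wpM2l q0 (IHn _ (a - p) an).
apply: le_trans (lerD IHy IHn) _; rewrite cQ.
rewrite le_eqVlt; apply/orP; left; apply/eqP; ring.
Qed.

Lemma prob_discrepancy (x : R) (t : dtree T) :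
  0 <= p <= 1 -> avoids set0 t -> 0 < x ->
  site_prob p (fun S => discrepancy t S <= - x) * x ^+ 2 <= p * #|T|%:R.
Proof.
move=> p01 at0 x0; have /andP[p0 p1] := p01.
have := discrepancy_second_moment 0 p01 at0; rewrite expr0n add0r setC0 cardsT.
set m := siteE _ _ => m_le; apply: le_trans (_ : m <= _); last first.
  apply: le_trans m_le _; rewrite ler_wpM2r // -[leRHS]mulr1 ler_wpM2l //; lra.
rewrite site_probE // mulrC -siteEZ; apply: siteE_le => // S.
case: asboolP => [dx|_]; rewrite /= ?mulr0 ?sqr_ge0 // mulr1 add0r; nra.
Qed.

End Discrepancy.

(** * Neighbourhoods and degrees into a set *)

Definition nbhd (T : finType) (e : rel T) (A : {set T}) : {set T} :=
  [set v | [exists a in A, e a v]].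

Lemma nbhdP (T : finType) (e : rel T) (A : {set T}) v :
  reflect (exists2 a, a \in A & e a v) (v \in nbhd e A).
Proof. by rewrite inE; apply: exists_inP. Qed.

Lemma nbhdU (T : finType) (e : rel T) (A B : {set T}) :
  nbhd e (A :|: B) = nbhd e A :|: nbhd e B.
Proof.
apply/setP => v; rewrite in_setU; apply/nbhdP/orP => [[a]|].
  by rewrite inE => /orP[aA|aB] eav; [left|right]; apply/nbhdP; exists a.
by case=> /nbhdP[a aA eav]; exists a; rewrite // inE aA ?orbT.
Qed.

Lemma card_nbhd_le (T : finType) (e : rel T) (d : nat) (A : {set T}) : regular e d ->
  (#|nbhd e A| <= d * #|A|)%N.
Proof.
move=> reg; have -> : nbhd e A = \bigcup_(a in A) [set u | e a u].
  by apply/setP => v; apply/nbhdP/bigcupP => -[a aA eav]; exists a; rewrite ?inE // in eav *.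
rewrite mulnC -sum_nat_const.
apply: leq_trans (_ : _ <= \sum_(a in A) #|[set u | e a u]|)%N _; last first.
  by apply: leq_sum => a _; rewrite reg.
elim/big_rec2: _ => [|a x y _ xy]; first by rewrite cards0.
by rewrite cardsU; lia.
Qed.

Definition degree_in (T : finType) (e : rel T) (C : {set T}) (v : T) : nat :=
  #|[set u in C | e v u]|.

(** The threshold is above the mean d |C| / n over all vertices of the degree
    into C, by a margin proportional to d. *)
Definition irregular (R : realType) (T : finType) (e : rel T) (d : nat) (eta : R)
    (C : {set T}) (a : T) : bool :=
  d%:R * #|C|%:R / #|T|%:R + eta * d%:R < (degree_in e C a)%:R.

(** * The search for an induced path *)

Section Search.
Variables (T : finType) (e : rel T).

(** The head of the sequence is the end of the path that grows. *)
Fixpoint induced_path (U : seq T) : bool :=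
  if U is v :: U1 then
    [&& v \notin U1, induced_path U1 &
        if U1 is u :: U2 then e u v && all (fun w => ~~ e w v) U2 else true]
  else true.

Lemma induced_path_uniq U : induced_path U -> uniq U.
Proof. by elim: U => //= v U IH /and3P[-> /IH ->]. Qed.

Section Walk.
Hypotheses (e_sym : symmetric e) (e_irr : irreflexive e).

Lemma induced_path_nth x0 U i j : induced_path U -> (i < size U)%N -> (j < size U)%N ->
  e (nth x0 U i) (nth x0 U j) = (j == i.+1) || (i == j.+1).
Proof.
elim: U i j => // v U IH.
have first_edge k : induced_path (v :: U) -> (k < size U)%N ->
    e (nth x0 U k) v = (k == 0).
  move=> /and3P[_ _]; case: U IH k => // u U _ [|k] /andP[euv /allP far] kU //.
  by apply: negPf (far _ _); apply: mem_nth.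
move=> [|i] [|j] pU iU jU; have /and3P[vU pU1 _] := pU.
- by rewrite /= e_irr.
- by rewrite /= e_sym first_edge // orbF eqSS.
- by rewrite /= first_edge.
- by rewrite /= IH.
Qed.

Lemma induced_path_spec (S : {set T}) v U : induced_path (v :: U) ->
  {subset v :: U <= S} -> has_induced_path (induced e S) (size U).
Proof.
move=> pU US; set W := v :: U.
have WS (i : 'I_(size U).+1) : nth v W i \in S by apply/US/mem_nth.
pose X := [set x : {x : T | x \in S} | val x \in W]; exists X.
pose f i : {x : T | x \in S} := exist (fun x => x \in S) _ (WS i).
have fX i : f i \in X by rewrite inE; apply: mem_nth.
exists (fun i => exist (fun x => x \in X) (f i) (fX i)); last first.
  by move=> i j; rewrite /induced /= induced_path_nth.
exists (fun y => inord (index (val (val y)) W)) => [i|y].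
  have idx : index (nth v W i) W = i.
    by apply: index_uniq; rewrite ?ltn_ord //; apply: induced_path_uniq.
  by apply: val_inj; rewrite [LHS]inordK [index _ _]idx ?ltn_ord.
have yW : val (val y) \in W by have := valP y; rewrite inE.
apply/val_inj/val_inj => /=.
by have iW := yW; rewrite -index_mem in iW; rewrite inordK // nth_index.
Qed.

End Walk.

(** The vertices that the search may query: those which, if retained, prolong
    the induced path U.  When U is empty any unqueried vertex may start a new
    path. *)
Definition extends (Q : {set T}) (U : seq T) v : bool :=
  (v \notin Q) && (if U is u :: U1 then e u v && all (fun w => ~~ e w v) U1 else true).

(** What the search guarantees when it stops with Q queried.  That the
    neighbours of F lie in Q or in the neighbourhood of U holds all along. *)
Definition search_outcome s (Q S : {set T}) : Prop :=
  let F := S :&: Q in exists U,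
    [/\ induced_path U, {subset U <= F}, nbhd e F \subset Q :|: nbhd e [set x in U] &
        (#|F| <= s)%N && ((#|F| == s) || (Q == setT))].

(** The search started in a state with queried set Q, found set F and stack U.
    A push preserves the inclusion of the neighbours of F, since U grows with
    F.  So does a pop: a neighbour of the popped vertex that is neither queried
    nor adjacent to the rest of the stack could still be queried.  The measure
    counts an unqueried vertex twice because querying it may push it on the
    stack: a push costs two units and brings back one, a pop costs one. *)
Lemma search_from m s (Q F : {set T}) (U : seq T) :
  (2 * #|~: Q| + size U <= m)%N ->
  (#|F| <= s)%N -> F \subset Q -> induced_path U -> {subset U <= F} ->
  nbhd e F \subset Q :|: nbhd e [set x in U] ->
  exists2 t, avoids Q t &
    forall S, S :&: Q = F -> search_outcome s (Q :|: queried t S) S.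
Proof.
elim: m Q F U => [|m IH] Q F U mQ Fs FQ pU UF NF.
  exists (Stop T) => // S /= SQ; rewrite /search_outcome setU0 SQ; exists U.
  split=> //; rewrite Fs; apply/orP; right; apply/eqP.
  have : (#|~: Q| == 0)%N by lia.
  by rewrite cards_eq0 => /eqP Q0; rewrite -[Q]setCK Q0 setC0.
have stop : (#|F| == s) || (Q == setT) -> exists2 t, avoids Q t &
    forall S, S :&: Q = F -> search_outcome s (Q :|: queried t S) S.
  move=> sQ; exists (Stop T) => // S /= SQ; rewrite /search_outcome setU0 SQ.
  by exists U; rewrite Fs.
have [Fe|Fne] := eqVneq #|F| s; first by apply: stop; rewrite Fe eqxx.
have [Qe|Qne] := eqVneq Q setT; first by apply: stop; rewrite Qe eqxx orbT.
have {Fne} Fs1 : (#|F| < s)%N by lia.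
case: (pickP (extends Q U)) => [v /andP[vQ vU]|noext].
  (* Some v can be queried; it is pushed when it is retained. *)
  have cQ : #|~: Q| = #|~: (v |: Q)|.+1.
    rewrite (cardsD1 v) inE vQ; congr _.+1; apply: eq_card => w.
    by rewrite !inE negb_or.
  have vF : v \notin F by apply: contra (subsetP FQ v) vQ.
  have [||||||no a_no no_ok] := IH (v |: Q) F U => //.
  - by lia.
  - by apply: subset_trans FQ (subsetUr _ _).
  - by rewrite -setUA (subset_trans NF) ?subsetUr.
  have [||||||yes a_yes yes_ok] := IH (v |: Q) (v |: F) (v :: U) => //.
  - by rewrite /=; lia.
  - by rewrite cardsU1 vF.
  - exact: setUS.
  - by rewrite /= pU (contra (UF v) vF).
  - move=> w; rewrite !inE => /orP[->//|/UF ->]; exact: orbT.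
  - rewrite set_cons !nbhdU subUset; apply/andP; split.
      by apply: subset_trans (subsetUr _ _); apply: subsetUl.
    apply: subset_trans NF _; apply/subsetP => w.
    by rewrite !in_setU => /orP[->|->]; rewrite !orbT.
  exists (Ask v no yes); first by rewrite /= vQ a_no.
  move=> S SQ /=; case: ifP => vS.
    rewrite setUCA setUA; apply: yes_ok.
    by rewrite setIUr SQ; congr (_ :|: _); apply/setIidPr; rewrite sub1set.
  rewrite setUCA setUA; apply: no_ok.
  rewrite setIUr SQ; apply/setUidPr/subsetP => w; rewrite !inE => /andP[wS /eqP wv].
  by rewrite -wv wS in vS.
(* The top u of the stack has nothing to query, and is popped. *)
case: U mQ pU UF NF noext {stop} => [|u U] mQ pU UF NF noext.
  case/eqP: Qne; apply/setP => w; rewrite inE.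
  by have := noext w; rewrite /extends andbT => /negbFE.
apply: (IH Q F U) => //; first by move: mQ => /=; lia.
- by case/and3P: pU.
- by move=> w wU; apply: UF; rewrite inE wU orbT.
apply/subsetP => w /(subsetP NF); rewrite !in_setU => /orP[->//|/nbhdP[a]].
rewrite !inE => /orP[/eqP->|aU] eaw; last first.
  by apply/orP; right; apply/exists_inP; exists a; rewrite ?inE.
have := noext w; rewrite /extends eaw /= => /negbT; rewrite negb_and negbK.
case/orP=> [->//|/allPn[b bU]]; rewrite negbK => ebw.
by apply/orP; right; apply/exists_inP; exists b; rewrite ?inE.
Qed.

Lemma search_tree s :
  exists2 t, avoids set0 t & forall S, search_outcome s (queried t S) S.
Proof.
have nbhd0 : nbhd e set0 = set0.
  by apply/setP => v; rewrite [RHS]inE; apply/negP => /nbhdP[a]; rewrite inE.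
have [||||||t t0 ht] := @search_from (2 * #|~: (set0 : {set T})| + 0) s set0 set0 [::];
  rewrite ?cards0 ?nbhd0 ?sub0set //.
by exists t => // S; have := ht S; rewrite setI0 set0U; apply.
Qed.

End Search.

(** * Degrees into a set under a spectral gap *)

Section Spectral.
Local Open Scope sesquilinear_scope.

Lemma char_poly_conj (F : fieldType) n (P A : 'M[F]_n) : P \in unitmx ->
  char_poly (invmx P *m A *m P) = char_poly A.
Proof.
move=> uP; pose Q : 'M[{poly F}]_n := map_mx (@polyC F) P.
pose Q' : 'M[{poly F}]_n := map_mx (@polyC F) (invmx P).
have QQ : Q' *m Q = 1%:M by rewrite -map_mxM /= mulVmx // map_mx1.
have -> : char_poly (invmx P *m A *m P) = \det (Q' *m char_poly_mx A *m Q).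
  rewrite /char_poly /char_poly_mx mulmxBr mulmxBl !map_mxM /=; congr (\det (_ - _)).
  by rewrite scalar_mxC -mulmxA QQ mulmx1.
by rewrite !det_mulmx mulrAC -det_mulmx QQ det1 mul1r.
Qed.

Lemma mulmx_trC_norm (C : numClosedFieldType) n (y : 'rV[C]_n) :
  (y *m y^t*) 0 0 = \sum_j `|y 0 j| ^+ 2.
Proof. by rewrite mxE; apply: eq_bigr => j _; rewrite !mxE -normCK. Qed.

(** The matrix A is diagonalised over the complex numbers in a unitary basis,
    where the eigenvalues are the entries of s up to a permutation.  The
    eigenvector w has eigenvalue d, which exceeds all of them but s_0 in
    absolute value, so w spans the line of s_0; being orthogonal to w, the
    vector f has only components on which A contracts by the factor lam. *)
Lemma orthogonal_contraction (R : realType) n (A : 'M[R]_n) (s : seq R) (lam d : R)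
    (w f : 'rV[R]_n) :
  A^T = A -> char_poly A = \prod_(x <- s) ('X - x%:P) ->
  (forall i, (0 < i < n)%N -> `|s`_i| <= lam) -> lam < d ->
  w != 0 -> w *m A = d *: w -> f *m w^T = 0 ->
  \sum_j (f *m A) 0 j ^+ 2 <= lam ^+ 2 * \sum_j f 0 j ^+ 2.
Proof.
move=> symA chA s_small lam_d w0 wA fw.
pose toC := real_complex R; pose B := map_mx toC A.
have conj_toC (x : R) : (toC x)^* = toC x by exact: conjc_real.
have conj_mx m1 m2 (M : 'M[R]_(m1, m2)) : (map_mx toC M)^t* = map_mx toC M^T.
  by apply/matrixP => i j; rewrite !mxE conj_toC.
have nB : B \is normalmx by apply/normalmxP; rewrite conj_mx symA.
pose P := spectralmx B; pose D := spectral_diag B.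
have uP : P \is unitarymx := spectral_unitarymx B.
have PP : P *m P^t* = 1%:M by apply/unitarymxP.
have unP := unitarymx_unit uP.
have BE : B = invmx P *m diag_mx D *m P by apply/orthomx_spectralP.
have abs_toC (x : R) : `|toC x| = toC `|x|.
  by rewrite normc_def /= expr0n addr0 sqrtr_sqr.
have norm_toC (x : R) : `|toC x| ^+ 2 = toC (x ^+ 2).
  by rewrite normCK conj_toC -rmorphM.
have chD : perm_eq (codom (D 0)) (map toC s).
  apply/prod_XsubC_eq.
  have -> : \prod_(x <- map toC s) ('X - x%:P) = char_poly B.
    rewrite -map_char_poly chA rmorph_prod big_map; apply: eq_bigr => x _.
    by rewrite rmorphB /= map_polyX map_polyC.
  rewrite BE char_poly_conj // char_poly_trig; last first.
    by apply: diag_mx_is_trig.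
  rewrite big_map big_enum; apply: eq_bigr => i _; by rewrite !mxE eqxx mulr1n.
have size_s : size (map toC s) == n.
  by rewrite -(perm_size chD) size_codom card_ord.
have [p Dp] : exists p : 'S_n, forall i, D 0 i = toC s`_(p i).
  have chDt : perm_eq [tuple D 0 i | i < n] (Tuple size_s).
    by apply: perm_trans chD; rewrite /= codomE.
  have [p Ep] := tuple_permP chDt; exists p => i.
  have := congr1 (nth 0 ^~ i) Ep; rewrite -!tnth_nth !tnth_mktuple => ->.
  by rewrite (tnth_nth 0) /= (nth_map 0) // -(size_map toC) (eqP size_s).
have D_small i : p i != 0%N :> nat -> `|D 0 i| <= toC lam.
  move=> pi0; rewrite Dp abs_toC lecR; apply: s_small.
  by rewrite lt0n pi0 ltn_ord.
pose y := map_mx toC f *m P^t*; pose z := map_mx toC w *m P^t*.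
have yP : map_mx toC f = y *m P by rewrite mulmxKtV.
have zP : map_mx toC w = z *m P by rewrite mulmxKtV.
have BP : B *m P^t* = P^t* *m diag_mx D.
  by rewrite BE invmx_unitary // -!mulmxA PP mulmx1.
have z_supp i : p i != 0%N :> nat -> z 0 i = 0.
  move=> pi0.
  have : z *m diag_mx D = toC d *: z.
    by rewrite -mulmxA -BP mulmxA -map_mxM wA map_mxZ -scalemxAl.
  move=> /rowP/(_ i); rewrite mul_mx_diag !mxE mulrC => /eqP.
  rewrite -subr_eq0 -mulrBl mulf_eq0 => /orP[/eqP Dd|/eqP //].
  have := D_small i pi0; rewrite (subr0_eq Dd) abs_toC lecR leNgt.
  by rewrite (lt_le_trans lam_d (ler_norm d)).
have y_supp i : p i = 0%N :> nat -> y 0 i = 0.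
  move=> pi0.
  have yz : y *m z^t* = 0.
    rewrite trmx_mul map_mxM trmxCK mulmxA mulmxKtV // conj_mx -map_mxM fw.
    by rewrite map_mx0.
  have z_i j : j != i -> z 0 j = 0.
    move=> ji; apply: z_supp; apply: contra ji => /eqP pj.
    by apply/eqP/(@perm_inj _ p)/val_inj; rewrite /= pj.
  have ztE j : z^t* j 0 = (z 0 j)^* by rewrite mxE [in LHS]mxE.
  have zi0 : z 0 i != 0.
    apply: contra w0 => /eqP zi; apply/eqP/(map_mx_inj (f := toC)); rewrite map_mx0 zP.
    rewrite (_ : z = 0) ?mul0mx //; apply/rowP => j; rewrite [RHS]mxE.
    by have [->|/z_i] := eqVneq j i.
  have := congr1 (fun M : 'M__ => M 0 0) yz; rewrite mxE [RHS]mxE (bigD1 i) //= big1 ?addr0.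
    by move/eqP; rewrite ztE mulf_eq0 conjC_eq0 (negPf zi0) orbF => /eqP.
  by move=> j ji; rewrite ztE z_i // conjC0 mulr0.
have norm_P (u : 'rV_n) : \sum_j `|(u *m P) 0 j| ^+ 2 = \sum_j `|u 0 j| ^+ 2.
  by rewrite -!mulmx_trC_norm trmx_mul map_mxM mulmxA mulmxtVK.
have norm_real (u : 'rV[R]_n) : toC (\sum_j u 0 j ^+ 2) = \sum_j `|map_mx toC u 0 j| ^+ 2.
  rewrite [LHS](rmorph_sum (real_complex R)); apply: eq_bigr => j _.
  by rewrite mxE norm_toC.
have fA : map_mx toC (f *m A) = (y *m diag_mx D) *m P.
  by rewrite map_mxM -/B BE invmx_unitary // !mulmxA.
rewrite -lecR rmorphM rmorphXn /= [X in X <= _]norm_real [X in _ * X]norm_real fA yP !norm_P.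
rewrite mulr_sumr; apply: ler_sum => j _; rewrite mul_mx_diag mxE normrM exprMn mulrC.
have [pj|pj] := eqVneq (p j : nat) 0%N.
  by rewrite y_supp // normr0 expr0n !mulr0.
rewrite ler_wpM2r ?exprn_ge0 // lerXn2r ?nnegrE ?normr_ge0 ?D_small //.
by apply: le_trans (D_small j pj).
Qed.

End Spectral.

Section NDL.
Variables (R : realType) (n d : nat) (lam : R) (e : rel 'I_n).
Hypothesis G : ndl_graph d lam e.
Hypotheses (n_gt1 : (1 < n)%N) (lam_d : lam < d%:R).

Lemma ndl_spectrum_gap s i : spectrum (adjmx R e) s ->
  (0 < i < n)%N -> `|s`_i| <= Num.max `|s`_1| `|s`_n.-1|.
Proof.
case=> s_sorted chA /andP[i0 i_n].
have size_s : size s = n.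
  by apply: succn_inj; rewrite -(size_char_poly (adjmx R e)) chA size_prod_XsubC.
have ge_trans : transitive (fun x y : R => y <= x).
  by move=> y x z xy yz; apply: le_trans yz xy.
have anti := @sorted_leq_nth _ _ ge_trans (fun x => lexx x) 0 s s_sorted.
have s_i1 : s`_i <= s`_1 by apply: anti; rewrite ?inE ?size_s.
have s_ni : s`_n.-1 <= s`_i by apply: anti; rewrite ?inE ?size_s; lia.
rewrite le_max; case: (ger0P s`_i) => _; first by rewrite (le_trans s_i1 (ler_norm _)).
by apply/orP; right; rewrite -normrN (le_trans _ (ler_norm _)) // lerN2.
Qed.

Lemma degree_in_setT v : degree_in e [set: 'I_n] v = d.
Proof.
by case: G => _ reg _; rewrite -(reg v); apply: eq_card => u; rewrite !inE.
Qed.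

(** The degrees into C are the entries of the image under the adjacency matrix
    of the indicator of C.  Subtracting the mean makes this indicator
    orthogonal to the constant vector, an eigenvector for d, so that its image
    is bounded through lam. *)
Lemma ndl_degree_variance (C : {set 'I_n}) :
  \sum_a ((degree_in e C a)%:R - d%:R * #|C|%:R / n%:R) ^+ 2
    <= lam ^+ 2 * (#|C|%:R - #|C|%:R ^+ 2 / n%:R).
Proof.
have n0 : n%:R != 0 :> R by rewrite pnatr_eq0; lia.
have [[e_sym e_irr] reg [s spec lamE]] := G.
pose A := adjmx R e.
pose c : R := #|C|%:R / n%:R.
pose f : 'rV[R]_n := \row_j ((j \in C)%:R - c).
pose w : 'rV[R]_n := const_mx 1.
have sumC : \sum_j (j \in C)%:R = #|C|%:R :> R.
  by rewrite -sum1_card natr_sum [RHS]big_mkcond; apply: eq_bigr => j _; case: (j \in C).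
have deg_sum (D : {set 'I_n}) a : \sum_j (j \in D)%:R * (e j a)%:R = (degree_in e D a)%:R :> R.
  rewrite /degree_in -sum1_card natr_sum [RHS]big_mkcond; apply: eq_bigr => j _.
  by rewrite inE [e a j]e_sym; case: (j \in D); case: (e j a); rewrite ?mul1r ?mul0r.
have deg_all a : \sum_j (e j a)%:R = d%:R :> R.
  rewrite -(degree_in_setT a) -deg_sum; apply: eq_bigr => j _.
  by rewrite inE mul1r.
have fA a : (f *m A) 0 a = (degree_in e C a)%:R - d%:R * #|C|%:R / n%:R.
  rewrite mxE (eq_bigr (fun j => (j \in C)%:R * (e j a)%:R - c * (e j a)%:R)).
    by rewrite sumrB deg_sum -mulr_sumr deg_all /c; ring.
  by move=> j _; rewrite !mxE mulrBl.
have ff : \sum_j f 0 j ^+ 2 = #|C|%:R - #|C|%:R ^+ 2 / n%:R.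
  rewrite (eq_bigr (fun j => (1 - 2 * c) * (j \in C)%:R + c ^+ 2)).
    rewrite big_split /= -mulr_sumr sumC sumr_const card_ord -mulr_natr /c; field; exact: n0.
  by move=> j _; rewrite mxE; case: (j \in C) => /=; ring.
under eq_bigr do rewrite -fA.
rewrite -ff; apply: (orthogonal_contraction (s := s) (d := d%:R) (w := w)) => //.
- by apply/matrixP => i j; rewrite !mxE e_sym.
- by case: spec.
- by move=> i ?; rewrite lamE; apply: ndl_spectrum_gap.
- by apply/eqP => /rowP/(_ (Ordinal (ltnW n_gt1))); rewrite !mxE; apply/eqP/oner_neq0.
- apply/rowP => a; rewrite !mxE mulr1 -[RHS](deg_all a).
  by apply: eq_bigr => j _; rewrite !mxE mul1r.
- apply/matrixP => i j; rewrite !mxE (eq_bigr (fun j => (j \in C)%:R - c)).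
    by rewrite sumrB sumC sumr_const card_ord -[c *+ n]mulr_natr /c divfK // subrr.
  by move=> k _; rewrite !mxE mulr1.
Qed.

Lemma ndl_lam_ge0 : 0 <= lam.
Proof. by case: G => _ _ [s _ ->]; rewrite le_max normr_ge0. Qed.

(** This is Chebyshev's inequality for the degrees into C. *)
Lemma ndl_few_irregular (C : {set 'I_n}) (eta : R) : 0 < eta ->
  #|[set a | irregular e d eta C a]|%:R * eta ^+ 2 * d%:R ^+ 2 <= lam ^+ 2 * n%:R.
Proof.
move=> eta0; set B := [set a | _].
have l2 : 0 <= lam ^+ 2 by rewrite exprn_ge0 // ndl_lam_ge0.
have Cn : #|C|%:R - #|C|%:R ^+ 2 / n%:R <= n%:R :> R.
  rewrite lerBlDr (le_trans (y := n%:R)) ?lerDl ?divr_ge0 ?exprn_ge0 //.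
  by rewrite ler_nat -[n in (_ <= n)%N]card_ord max_card.
apply: le_trans (ler_wpM2l l2 Cn); apply: le_trans (ndl_degree_variance C).
rewrite -mulrA -exprMn mulr_natl -sumr_const [leRHS](bigID (mem B)) /=.
rewrite -[leLHS]addr0 lerD ?sumr_ge0 // => [|a _]; last by rewrite sqr_ge0.
apply: ler_sum => a; rewrite inE /irregular card_ord => aB.
have ed0 : 0 <= eta * d%:R by rewrite mulr_ge0 // ltW.
set x := d%:R * _ / _ in aB * => /=; set y := eta * _ in aB ed0 * => /=.
set z := (degree_in _ _ _)%:R in aB *.
nra.
Qed.

(** This makes (1 + eps) / d a probability.  In a perfect matching, the only
    neighbour of a vertex v has degree 1 into the singleton of v, too far from
    the mean 1/n. *)
Lemma ndl_degree_ge2 : (0 < d)%N -> lam <= d%:R / 2 -> (1 < d)%N.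
Proof.
move=> d0 lam2.
have v : 'I_n := Ordinal (ltnW n_gt1).
have := ndl_degree_variance [set v]; rewrite cards1.
have [[e_sym e_irr] reg _] := G.
case: (ltngtP d 1%N) => // [|d1]; first by rewrite ltnNge d0.
move=> var.
have /card_gt0P[u] : (0 < #|[set u | e v u]|)%N by rewrite reg.
rewrite inE => evu.
have degu : degree_in e [set v] u = 1%N.
  rewrite /degree_in (_ : [set _ in _ | _] = [set v]) ?cards1 //.
  by apply/setP => x; rewrite !inE; case: eqP => //= ->; rewrite e_sym.
have n2 : 2 <= n%:R :> R by rewrite (ler_nat _ 2).
have n0 : n%:R != 0 :> R by rewrite pnatr_eq0; lia.
have ninv : n%:R * n%:R^-1 = 1 :> R by rewrite divff.
have : (1 - n%:R^-1) ^+ 2 <= lam ^+ 2 * (1 - n%:R^-1) :> R.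
  move: var; rewrite expr1n mul1r mulr1 d1 mul1r => var; apply: le_trans var.
  by rewrite (bigD1 u) //= degu lerDl sumr_ge0 // => a _; rewrite sqr_ge0.
have : lam ^+ 2 <= 4^-1.
  rewrite (_ : 4^-1 = (d%:R / 2) ^+ 2); last by rewrite d1; field.
  by rewrite lerXn2r ?nnegrE ?ndl_lam_ge0 // divr_ge0.
have : 0 < n%:R^-1 :> R by rewrite invr_gt0; lra.
nra.
Qed.

End NDL.

(** * All large subsets of the random set expand *)

Lemma sum_tuple_cons (V : nmodType) (T : finType) m (F : m.+1.-tuple T -> V) :
  \sum_t F t = \sum_a \sum_(t : m.-tuple T) F (cons_tuple a t).
Proof.
rewrite pair_big (reindex (fun q : T * m.-tuple T => cons_tuple q.1 q.2)) //=.
exists (fun t => (thead t, [tuple of behead t])) => [[a t] _|t _] /=.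
  by rewrite theadE; congr pair; apply: val_inj.
by rewrite [RHS]tuple_eta; apply: val_inj.
Qed.

(** A weak form of s! >= (s / e)^s: both sides compare with
    (s + 1) (s + 2) ... (2 s). *)
Lemma expn_self_le s : (s ^ s <= 4 ^ s * s`!)%N.
Proof.
have binom : ('C(s + s, s) <= 4 ^ s)%N.
  rewrite -[4%N]/(2 ^ 2)%N -expnM mul2n -addnn -[2%N]/(1 + 1)%N expnDn.
  rewrite (bigD1 (inord s)) //= inordK ?ltnS ?leq_addr // !exp1n !muln1.
  exact: leq_addr.
apply: leq_trans (leq_mul binom (leqnn _)); rewrite bin_ffact.
have : forall m, (s ^ m <= (s + m) ^_ m)%N.
  elim=> // m IH; rewrite expnS addnS ffactnS leq_mul //; first by lia.
by apply.
Qed.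

Section Expansion.
Variables (R : realType) (T : finType) (e : rel T) (d : nat) (eta : R).
Hypotheses (reg : regular e d) (eta0 : 0 <= eta).

Let n : R := #|T|%:R.

(** Lists are read as being built from their last entry, as in the inductions
    below. *)
Fixpoint irregular_count (l : seq T) : nat :=
  if l is a :: l1 then (irregular e d eta (nbhd e [set x in l1]) a + irregular_count l1)%N
  else 0%N.

(** Each new vertex a adds d minus its degree into the current neighbourhood C,
    where |C| <= d i at step i.  A regular a thus adds at least
    d - d^2 i / n - eta d, and an irregular one at least 0; summing over i
    gives the quadratic term. *)
Lemma card_nbhd_irregular l :
  d%:R * (size l)%:R - d%:R ^+ 2 * (size l)%:R ^+ 2 / (2 * n) - eta * d%:R * (size l)%:R
    - d%:R * (irregular_count l)%:R <= #|nbhd e [set x in l]|%:R.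
Proof.
elim: l => [|a l IH]; first by rewrite !mulr0 expr0n !(mulr0, mul0r, subr0).
have n0 : 0 < n by rewrite ltr0n; apply/card_gt0P; exists a.
rewrite set_cons nbhdU; set C := nbhd e [set x in l] in IH *.
have Na : nbhd e [set a] = [set u | e a u].
  apply/setP => v; rewrite [RHS]inE; apply/nbhdP/idP => [[b]|eav].
    by rewrite inE => /eqP ->.
  by exists a; rewrite ?inE.
have -> : #|nbhd e [set a] :|: C|%:R = d%:R + #|C|%:R - (degree_in e C a)%:R :> R.
  rewrite Na; apply/eqP; rewrite eq_sym subr_eq -!natrD eqr_nat cardsU reg.
  rewrite (_ : _ :&: C = [set u in C | e a u]); last by apply/setP => u; rewrite !inE andbC.
  rewrite -/(degree_in e C a) subnK //.
  rewrite (leq_trans (subset_leq_card (_ : _ \subset C))) ?leq_addl //.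
  by apply/subsetP => u; rewrite inE => /andP[].
have Cd : #|C|%:R <= d%:R * (size l)%:R :> R.
  rewrite -natrM ler_nat (leq_trans (card_nbhd_le _ reg)) // leq_mul2l; apply/orP; right.
  by rewrite cardsE card_size.
have dega_le : (degree_in e C a)%:R <= d%:R :> R.
  by rewrite ler_nat -(reg a) subset_leq_card //; apply/subsetP => u; rewrite !inE => /andP[].
have Cdn : d%:R * #|C|%:R / n <= d%:R ^+ 2 * (size l)%:R / n.
  by rewrite ler_pM2r ?invr_gt0 // expr2 -mulrA ler_wpM2l.
have ed : 0 <= eta * d%:R by rewrite mulr_ge0.
have dn : 0 <= d%:R ^+ 2 / n by rewrite divr_ge0 ?(ltW n0) ?exprn_ge0.
have dnl : 0 <= d%:R ^+ 2 * (size l)%:R / n.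
  by rewrite divr_ge0 ?(ltW n0) // mulr_ge0 // exprn_ge0.
have -> : d%:R ^+ 2 * (size (a :: l))%:R ^+ 2 / (2 * n) =
    d%:R ^+ 2 * (size l)%:R ^+ 2 / (2 * n) + d%:R ^+ 2 * (size l)%:R / n + d%:R ^+ 2 / n / 2.
  rewrite /= -natr1; field; exact: lt0r_neq0.
rewrite [irregular_count _]/= natrD [size (a :: l)]/= -natr1 /irregular -/n -/C.
case: ltP => /= deg; lra.
Qed.

(** When the tuple is built from its last entry, whatever was chosen before,
    the next entry multiplies the weight by M for at most n / M of its n
    values and by 1 for the others: the total gains a factor of at most 2 n. *)
Lemma sum_irregular_weight (M : R) m : 0 <= M ->
  (forall C, M * #|[set a | irregular e d eta C a]|%:R <= n) ->
  \sum_(t : m.-tuple T) M ^+ irregular_count t <= (2 * n) ^+ m.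
Proof.
move=> M0 few_irregular; have n0 : 0 <= n by rewrite ler0n.
elim: m => [|m IH].
  rewrite (big_pred1 [tuple]) ?expr0 // => t.
  by apply/esym/eqP; apply: tuple0.
rewrite sum_tuple_cons exchange_big exprS /=.
apply: le_trans (_ : \sum_(t : m.-tuple T) 2 * n * M ^+ irregular_count t <= _); last first.
  by rewrite -mulr_sumr ler_wpM2l // mulr_ge0.
apply: ler_sum => t _; under eq_bigr do rewrite exprD.
rewrite -mulr_suml ler_wpM2r ?exprn_ge0 //; set C := nbhd _ _.
apply: le_trans (_ : \sum_a (1 + M * (irregular e d eta C a)%:R) <= _).
  by apply: ler_sum => a _; case: irregular; rewrite /= ?expr1 ?expr0; lra.
rewrite big_split /= sumr_const -mulr_sumr cardE -cardT.
have -> : \sum_a (irregular e d eta C a)%:R = #|[set a | irregular e d eta C a]|%:R :> R.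
  rewrite -sum1_card natr_sum [RHS]big_mkcond; apply: eq_bigr => a _.
  by rewrite inE; case: irregular.
have := few_irregular C; rewrite -[n]/(#|T|%:R); lra.
Qed.

(** One of the two errors eta d s pays for the margin in the degrees of regular
    entries, the other for a loss of d at each of at most eta s irregular
    ones. *)
Definition poorly_expanding (s : nat) (A : {set T}) : bool :=
  (#|A| == s) && (#|nbhd e A|%:R < d%:R * s%:R - d%:R ^+ 2 * s%:R ^+ 2 / (2 * n)
                    - 2 * eta * d%:R * s%:R).

(** A poorly expanding set has s! orderings.  Each of them has more than s / k
    irregular entries, and thus weight at least K^s when an irregular entry
    weighs K^k. *)
Lemma card_poorly_expanding (K : R) (k s : nat) :
  1 <= K -> (0 < d)%N -> (0 < k)%N -> eta = k%:R^-1 ->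
  (forall C, K ^+ k * #|[set a | irregular e d eta C a]|%:R <= n) ->
  #|[set A | poorly_expanding s A]|%:R * s`!%:R * K ^+ s <= (2 * n) ^+ s.
Proof.
move=> K1 d0 k0 etak few_irregular.
have Kk0 : 0 <= K ^+ k by rewrite exprn_ge0 // (le_trans ler01).
apply: le_trans (sum_irregular_weight s Kk0 few_irregular).
rewrite (partition_big (fun t : s.-tuple T => [set x in t]) predT) //=.
rewrite -mulrA mulr_natl -sumr_const big_mkcond; apply: ler_sum => A _.
have sum0 : 0 <= \sum_(t : s.-tuple T | [set x in t] == A) (K ^+ k) ^+ irregular_count t.
  by apply: sumr_ge0 => t _; rewrite exprn_ge0.
rewrite inE; case: ifP => // /andP[/eqP As poor].
rewrite -[s in s`!]As -ffactnn [X in (_ ^_ X)%N]As -card_uniq_tuples mulr_natl -sumr_const.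
rewrite big_mkcond [leRHS]big_mkcond; apply: ler_sum => t _; rewrite inE.
case: ifP => [/andP[tA tu]|_]; last first.
  by case: ifP => // _; rewrite exprn_ge0.
have tAE : [set x in t] = A.
  apply/eqP; rewrite eqEcard; apply/andP; split.
    by apply/subsetP => x; rewrite inE => /(allP tA).
  by rewrite cardsE (card_uniqP tu) size_tuple As.
rewrite tAE eqxx -exprM ler_weXn2l //.
have := card_nbhd_irregular t; rewrite tAE size_tuple => /le_lt_trans /(_ poor).
have d0' : 0 < d%:R :> R by rewrite ltr0n.
have k0' : 0 < k%:R :> R by rewrite ltr0n.
move=> lt_poor; have : eta * s%:R < (irregular_count t)%:R.
  rewrite -(ltr_pM2l d0'); lra.
rewrite etak mulrC ltr_pdivrMr // -natrM ltr_nat mulnC => /ltnW //.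
Qed.

(** The expected number of poorly expanding subsets of the random set is at
    most (2 n p / K)^s / s!, hence at most (4 s / (eps K))^s / s!, and by
    [expn_self_le] at most (16 / (eps K))^s = 2^-s <= 1 / s. *)
Lemma prob_poorly_expanding (K p eps : R) (k s : nat) :
  1 <= K -> (0 < d)%N -> (0 < k)%N -> eta = k%:R^-1 ->
  (forall C, K ^+ k * #|[set a | irregular e d eta C a]|%:R <= n) -> 0 <= p <= 1 ->
  0 < eps -> eps * K = 32 -> eps * (2 * n * p) <= 4 * s%:R ->
  site_prob p (fun S => exists2 A, poorly_expanding s A & A \subset S) * s%:R <= 1.
Proof.
move=> K1 d0 k0 etak few_irregular p01 eps0 epsK sn; have /andP[p0 _] := p01.
have K0 : 0 < K by apply: lt_le_trans K1.
set prob := site_prob _ _.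
have prob0 : 0 <= prob by apply: site_prob_ge0.
have prob_le : prob <= #|[set A | poorly_expanding s A]|%:R * p ^+ s.
  apply: le_trans (site_prob_exists p01 _ _) _.
  rewrite (eq_bigr (fun=> p ^+ s)); last first.
    by move=> A /andP[/eqP <- _]; rewrite site_prob_subset.
  by rewrite sumr_const [leRHS]mulr_natl cardsE.
have s0 : 0 < s`!%:R :> R by rewrite ltr0n fact_gt0.
have Ks0 : 0 < K ^+ s by rewrite exprn_gt0.
have le1 : prob * K ^+ s * s`!%:R <= (2 * n * p) ^+ s.
  rewrite exprMn -mulrA; apply: le_trans (ler_wpM2r _ prob_le) _.
    by rewrite mulr_ge0 // ltW.
  set c := #|_|%:R; have -> : c * p ^+ s * (K ^+ s * s`!%:R) = c * s`!%:R * K ^+ s * p ^+ s.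
    by ring.
  by rewrite ler_wpM2r ?exprn_ge0 //; apply: (card_poorly_expanding (k := k)).
have le2 : (eps * (2 * n * p)) ^+ s <= 16 ^+ s * s`!%:R.
  apply: le_trans (_ : (4 * s%:R) ^+ s <= _).
    by rewrite lerXn2r ?nnegrE ?mulr_ge0 // ltW.
  rewrite (_ : 16 = 4 * 4) ?exprMn; last by rewrite -natrM.
  rewrite -mulrA ler_wpM2l ?exprn_ge0 // -!natrX -natrM ler_nat; exact: expn_self_le.
have le3 : prob * 2 ^+ s <= 1.
  have le13 : eps ^+ s * (prob * K ^+ s * s`!%:R) <= 16 ^+ s * s`!%:R.
    apply: le_trans le2; rewrite exprMn ler_wpM2l // exprn_ge0 // ltW //.
  move: le13; rewrite !mulrA ler_pM2r // [eps ^+ s * _]mulrC -mulrA -exprMn epsK.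
  rewrite (_ : 32 = 16 * 2 :> R) ?exprMn; last by rewrite -natrM.
  by rewrite mulrCA -[leRHS]mulr1 ler_pM2l // exprn_gt0.
apply: le_trans le3; rewrite ler_wpM2l // -natrX ler_nat ltnW // ltn_expl //.
Qed.

End Expansion.

(** * The length of the path *)

(** The left-hand side is what the theorem asks for, plus one since a path has
    one more vertex than edges.  On the right, s - s / (1 + eps) is at least
    (9/10) eps^2 N and s^2 / (2 N) is close to eps^2 N / 2, while the two error
    terms take eps^2 N / 50 each. *)
Lemma path_length_bound (R : realType) (eps N s eta : R) :
  0 < eps -> eps <= 1 / 10 -> 1000 <= eps ^+ 2 * N ->
  eps * N < s -> s <= eps * N + 1 -> 0 <= eta -> eta <= eps / 100 ->
  eps ^+ 2 * N / 3 + 1 <=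
  s - s ^+ 2 / (2 * N) - 2 * eta * s - (s + eps ^+ 2 * N / 50) / (1 + eps).
Proof.
move=> eps_gt0 eps_small N_large s_gt s_le eta_ge0 eta_small.
have e2 : 0 < eps ^+ 2 by rewrite exprn_gt0.
have N0 : 0 < N by rewrite -(pmulr_rgt0 _ e2); lra.
have N_ge : 1000 <= N by nra.
have e1 : 0 < 1 + eps by lra.
have s0 : 0 < s by apply: lt_trans s_gt; rewrite mulr_gt0.
have A : s - s / (1 + eps) >= 9 / 10 * (eps ^+ 2 * N).
  have -> : s - s / (1 + eps) = s * eps / (1 + eps) by field; rewrite gt_eqF.
  rewrite ler_pdivlMr //.
  have : eps * (eps * N) <= eps * s by rewrite ler_wpM2l // ltW.
  have : eps ^+ 2 * N * eps <= eps ^+ 2 * N * (1 / 10) by rewrite ler_wpM2l //; lra.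
  lra.
have B : s ^+ 2 / (2 * N) <= eps ^+ 2 * N / 2 + 1 / 5.
  rewrite ler_pdivrMr ?mulr_gt0 //.
  have : s ^+ 2 <= (eps * N + 1) ^+ 2 by rewrite lerXn2r ?nnegrE; lra.
  have : eps * N <= 1 / 10 * N by rewrite ler_wpM2r // ltW.
  lra.
have C : 2 * eta * s <= eps ^+ 2 * N / 50 + 1 / 100.
  have : eta * s <= eps / 100 * (eps * N + 1) by rewrite ler_pM ?(ltW s0).
  lra.
have D : eps ^+ 2 * N / 50 / (1 + eps) <= eps ^+ 2 * N / 50.
  rewrite ler_pdivrMr // ler_peMr; lra.
rewrite [(s + _) / _]mulrDl; lra.
Qed.

(** When the search ends with s vertices found, [path_length_bound] applies to
    the stack.  It cannot end by querying all the vertices earlier, as about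
    (1 + eps) N > s of them would then be found. *)
Lemma long_path_of_typical (R : realType) (T : finType) (e : rel T) (d s : nat)
    (t : dtree T) (eps eta : R) (S : {set T}) :
  let n : R := #|T|%:R in let N := n / d%:R in let p := (1 + eps) / d%:R in
  symmetric e -> irreflexive e -> regular e d -> (0 < d)%N ->
  0 < eps <= 1 / 10 -> 1000 <= eps ^+ 2 * N -> eps * N < s%:R <= eps * N + 1 ->
  0 <= eta <= eps / 100 ->
  search_outcome e s (queried t S) S ->
  ~ (discrepancy p t S <= - (eps ^+ 2 * N / 50)) ->
  ~ (exists2 A, poorly_expanding e d eta s A & A \subset S) ->
  exists2 l : nat, eps ^+ 2 * n / (3 * d%:R) <= l%:R &
    has_induced_path (induced e S) l.
Proof.
move=> n N p e_sym e_irr reg d0 /andP[eps0 eps1] N_large /andP[s_gt s_le] /andP[eta0 eta1].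
move=> [U [pU UF NF /andP[Fs stop]]] /negP; rewrite -ltNge => disc expand.
have d0' : 0 < d%:R :> R by rewrite ltr0n.
have e2 : 0 < eps ^+ 2 by rewrite exprn_gt0.
have N0 : 0 < N by rewrite -(pmulr_rgt0 _ e2); lra.
have N_ge : 1000 <= N by nra.
have nE : n = d%:R * N by rewrite /N; field; rewrite gt_eqF.
set Q := queried t S in NF stop disc *; set F := S :&: Q in UF NF Fs stop disc *.
have {}disc : p * #|Q|%:R < #|F|%:R + eps ^+ 2 * N / 50.
  by move: disc; rewrite /discrepancy -/Q -/F; lra.
have pd : p * d%:R = 1 + eps by rewrite /p divfK // gt_eqF.
have Fe : #|F| = s.
  case/orP: stop => [/eqP //|/eqP QT].
  have : #|F|%:R <= s%:R :> R by rewrite ler_nat.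
  have : p * #|Q|%:R = (1 + eps) * N by rewrite QT cardsT -/n nE mulrA pd.
  have : eps ^+ 2 * N <= 1 * N by rewrite ler_wpM2r ?(ltW N0) // expr_le1 ?ltW //; lra.
  by move=> *; exfalso; lra.
have expF : d%:R * s%:R - d%:R ^+ 2 * s%:R ^+ 2 / (2 * n) - 2 * eta * d%:R * s%:R
    <= #|nbhd e F|%:R.
  rewrite leNgt; apply/negP => poor; apply: expand; exists F; last exact: subsetIl.
  by rewrite /poorly_expanding Fe eqxx.
have NFc : #|nbhd e F|%:R <= #|Q|%:R + d%:R * (size U)%:R :> R.
  rewrite -natrM -natrD ler_nat; apply: leq_trans (subset_leq_card NF) _.
  rewrite cardsU (leq_trans (leq_subr _ _)) // leq_add2l.
  rewrite (leq_trans (card_nbhd_le _ reg)) // leq_mul2l cardsE card_size orbT //.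
have Qle : #|Q|%:R <= d%:R * ((s%:R + eps ^+ 2 * N / 50) / (1 + eps)).
  rewrite mulrA ler_pdivlMr; last lra.
  rewrite -pd [_ * (p * _)]mulrA [_ * p]mulrC [leLHS]mulrC ler_pM2l //.
  by rewrite -Fe ltW.
have bound := path_length_bound eps0 eps1 N_large s_gt s_le eta0 eta1.
have size_U : eps ^+ 2 * N / 3 + 1 <= (size U)%:R.
  apply: le_trans bound _; rewrite -(ler_pM2l d0') !mulrBr.
  have -> : d%:R * (s%:R ^+ 2 / (2 * N)) = d%:R ^+ 2 * s%:R ^+ 2 / (2 * n).
    by rewrite nE; field; rewrite !gt_eqF.
  lra.
case: U pU UF {NF NFc} size_U => [|v U] pU UF size_U; first by move: size_U => /=; lra.
exists (size U).
  have -> : eps ^+ 2 * n / (3 * d%:R) = eps ^+ 2 * N / 3 by rewrite nE; field; rewrite gt_eqF.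
  by move: size_U; rewrite /= -natr1; lra.
by apply: induced_path_spec pU _ => // w /UF; rewrite inE => /andP[].
Qed.

(** The inverse of the margin eta that defines irregular vertices, small enough
    that the errors 2 eta s stay below eps^2 N / 50. *)
Definition slack_index (R : realType) (eps : R) : nat := (Num.truncn (100 / eps)).+1.

(** The proportion of irregular vertices is at most (delta k)^2, with k the
    slack index; it has to be at most K^-k, where K = 32 / eps. *)
Definition gap_bound (R : realType) (eps : R) : R :=
  ((slack_index eps)%:R * (32 / eps) ^+ slack_index eps)^-1.

(** The two ways to fail have probability at most 1 / s, which is O(d/n), and
    at most p n / x^2 with x = eps^2 N / 50, which is O(1/N) = O(d/n) too. *)
Lemma prob_long_path (R : realType) (n d : nat) (lam eps : R) (e : rel 'I_n) :
  0 < eps <= 1 / 10 -> (0 < d)%N -> ndl_graph d lam e ->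
  lam / d%:R <= gap_bound eps -> 1000 * d%:R <= eps ^+ 2 * n%:R ->
  1 - 3000 / eps ^+ 4 * (d%:R / n%:R) <=
  site_prob ((1 + eps) / d%:R) (fun S : {set 'I_n} =>
    exists2 l : nat, eps ^+ 2 * n%:R / (3 * d%:R) <= l%:R &
      has_induced_path (induced e S) l) <= 1.
Proof.
move=> eps_bounds d0 G lam_le n_large; have /andP[eps0 eps1] := eps_bounds.
have d0' : 0 < d%:R :> R by rewrite ltr0n.
have d1 : 1 <= d%:R :> R by rewrite ler1n.
have e2 : 0 < eps ^+ 2 by rewrite exprn_gt0.
have e21 : eps ^+ 2 <= 1 by nra.
have n1000 : 1000 <= n%:R :> R by nra.
have n_gt1 : (1 < n)%N by rewrite -(ltr_nat R); lra.
pose k := slack_index eps; pose K := 32 / eps; pose eta : R := k%:R^-1.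
have k1 : 1 <= k%:R :> R by rewrite ler1n.
have K2 : 2 <= K by rewrite ler_pdivlMr; lra.
have K1 : 1 <= K by lra.
have Kk : 2 <= K ^+ k.
  by apply: le_trans K2 _; rewrite -[leLHS]expr1 ler_weXn2l.
have kK : 2 <= k%:R * K ^+ k by nra.
have lam0 : 0 <= lam := ndl_lam_ge0 G.
have lam_kK : lam * (k%:R * K ^+ k) <= d%:R.
  have kK0 : 0 < k%:R * K ^+ k by lra.
  by move: lam_le; rewrite ler_pdivrMr // /gap_bound -/k -/K mulrC ler_pdivlMr.
have lam2 : lam <= d%:R / 2 by nra.
have lam_d : lam < d%:R by lra.
have d2 := ndl_degree_ge2 G n_gt1 lam_d d0 lam2.
have d2' : 2 <= d%:R :> R by rewrite (ler_nat _ 2).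
set p := (1 + eps) / d%:R.
have p01 : 0 <= p <= 1.
  by rewrite divr_ge0 ?ler_pdivrMr // ?mul1r; lra.
have eta_gt0 : 0 < eta by rewrite invr_gt0; lra.
have eta_small : eta <= eps / 100.
  have : 100 / eps < k%:R by rewrite /k /slack_index truncnS_gt // divr_ge0 // ltW.
  rewrite ltr_pdivrMr // => h.
  by rewrite /eta -[_^-1]mul1r ler_pdivrMr; nra.
have few C : K ^+ k * #|[set a | irregular e d eta C a]|%:R <= #|'I_n|%:R.
  have := ndl_few_irregular G n_gt1 lam_d C eta_gt0.
  rewrite card_ord; set b : R := #|_|%:R => hb.
  have b0 : 0 <= b by rewrite ler0n.
  have {}hb : b * d%:R ^+ 2 <= (lam * k%:R) ^+ 2 * n%:R.
    have -> : b * d%:R ^+ 2 = k%:R ^+ 2 * (b * eta ^+ 2 * d%:R ^+ 2).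
      by rewrite /eta; field; rewrite gt_eqF //; lra.
    by rewrite exprMn [lam ^+ 2 * _]mulrC -[leRHS]mulrA ler_wpM2l // exprn_ge0.
  have {}hb : b * d%:R ^+ 2 * (K ^+ k) ^+ 2 <= d%:R ^+ 2 * n%:R.
    apply: le_trans (ler_wpM2r _ hb) _; first by rewrite sqr_ge0.
    rewrite mulrAC -exprMn -[lam * _ * _]mulrA ler_wpM2r // lerXn2r ?nnegrE ?mulr_ge0 //; lra.
  have : b * (K ^+ k) ^+ 2 <= n%:R.
    rewrite -(ler_pM2l (exprn_gt0 2 d0')); lra.
  apply: le_trans; rewrite mulrC ler_wpM2l // expr2; nra.
pose N : R := n%:R / d%:R.
have nE : n%:R = d%:R * N by rewrite /N; field; rewrite gt_eqF.
have N_large : 1000 <= eps ^+ 2 * N by rewrite mulrA ler_pdivlMr.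
have N0 : 0 < N by rewrite -(pmulr_rgt0 _ e2); lra.
pose s := (Num.truncn (eps * N)).+1.
have s_gt : eps * N < s%:R by rewrite truncnS_gt // mulr_ge0 ?ltW.
have s_le : s%:R <= eps * N + 1.
  by rewrite -natr1 lerD2r truncn_le // mulr_ge0 ?ltW.
have [[e_sym e_irr] reg _] := G.
have [t t0 ht] := search_tree e s.
pose x := eps ^+ 2 * N / 50.
have x0 : 0 < x by rewrite /x; lra.
set good := (X in site_prob p X).
pose bad1 (S : {set 'I_n}) := exists2 A, poorly_expanding e d eta s A & A \subset S.
pose bad2 S := discrepancy p t S <= - x.
have bad1_le : site_prob p bad1 * s%:R <= 1.
  apply: (@prob_poorly_expanding _ _ _ _ _ _ _ K p eps k) => //.
  - exact: ltW.
  - by rewrite /K; field; rewrite gt_eqF.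
  - rewrite card_ord.
    have -> : eps * (2 * n%:R * p) = 2 * (1 + eps) * (eps * N).
      by rewrite /p /N; ring.
    nra.
have bad2_le : site_prob p bad2 * x ^+ 2 <= p * n%:R.
  by have := prob_discrepancy p01 t0 x0; rewrite card_ord.
rewrite site_prob_le1 // andbT site_probC.
have bad_le : site_prob p (fun S => ~ good S) <= site_prob p bad1 + site_prob p bad2.
  apply: le_trans (site_probU p01 _ _); apply: site_prob_le => // S ngood.
  have [b1|nb1] := pselect (bad1 S); first by left.
  right; apply: contrapT => nb2; apply: ngood; rewrite /good -[n in n%:R]card_ord.
  apply: (long_path_of_typical (t := t) (s := s) (eta := eta)) => //; rewrite ?card_ord -/N //.
  - by rewrite s_gt.
  - by rewrite ltW.
have p1_le : site_prob p bad1 <= (eps * N)^-1.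
  have b0 := site_prob_ge0 p01 bad1.
  rewrite -[_^-1]mul1r ler_pdivlMr ?(mulr_gt0 eps0 N0) //.
  by apply: le_trans bad1_le; rewrite ler_wpM2l // ltW.
have p2_le : site_prob p bad2 <= 2750 / (eps ^+ 4 * N).
  have b0 := site_prob_ge0 p01 bad2.
  have pn : p * n%:R = (1 + eps) * N by rewrite /p /N; ring.
  rewrite ler_pdivlMr; last by rewrite mulr_gt0 ?exprn_gt0.
  rewrite -(ler_pM2r N0).
  have -> : site_prob p bad2 * (eps ^+ 4 * N) * N = 2500 * (site_prob p bad2 * x ^+ 2).
    by rewrite /x; field.
  nra.
have -> : 3000 / eps ^+ 4 * (d%:R / n%:R) = 3000 / (eps ^+ 4 * N).
  rewrite nE; field; rewrite !gt_eqF //.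
have : (eps * N)^-1 <= 250 / (eps ^+ 4 * N).
  have -> : 250 / (eps ^+ 4 * N) = (250 / eps ^+ 3) * (eps * N)^-1.
    by field; rewrite !gt_eqF.
  have inv0 : 0 <= (eps * N)^-1 by rewrite invr_ge0 ltW // mulr_gt0.
  rewrite -[leLHS]mul1r ler_wpM2r // ler_pdivlMr ?exprn_gt0 // mul1r exprS; nra.
have -> : 3000 / (eps ^+ 4 * N) = 250 / (eps ^+ 4 * N) + 2750 / (eps ^+ 4 * N).
  by rewrite -mulrDl; congr (_ / _); rewrite -natrD.
lra.
Qed.

(** * The limit *)

From mathcomp Require Import classical_sets topology normedtype landau sequences.
Import numFieldNormedType.Exports.
Local Open Scope classical_set_scope.
Unset Implicit Arguments.

Theorem theorem2 (R : realType) :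
  exists2 eps0 : R, 0 < eps0 &
  forall eps : R, 0 < eps <= eps0 ->
  exists2 delta : R, 0 < delta &
  forall (n d : nat -> nat) (lam : nat -> R) (G : forall k : nat, rel 'I_(n k)),
    n @ \oo --> \oo ->
    (forall k, (0 < d k)%N) ->
    (fun k => (d k)%:R : R^o) =o_\oo (fun k => (n k)%:R : R^o) ->
    (forall k, ndl_graph (d k) (lam k) (G k)) ->
    (forall k, lam k / (d k)%:R <= delta) ->
    (fun k => site_prob ((1 + eps) / (d k)%:R)
       (fun S : {set 'I_(n k)} =>
          exists2 l : nat, eps ^+ 2 * (n k)%:R / (3 * (d k)%:R) <= l%:R &
            has_induced_path (induced (G k) S) l)) @ \oo --> (1 : R).
Proof.
exists (1 / 10) => [|eps eps_bounds]; first by rewrite divr_gt0.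
have /andP[eps0 _] := eps_bounds.
exists (gap_bound eps).
  by rewrite invr_gt0 mulr_gt0 ?exprn_gt0 ?divr_gt0 ?ltr0n.
move=> n d lam G _ d_gt0 d_small ndl gap.
have sparse (c : R) : 0 < c -> \forall k \near \oo, (d k)%:R <= c * (n k)%:R.
  move=> c0; have /eqoP/(_ c c0) := d_small; apply: filterS => k.
  by rewrite /= !normr_nat.
apply/cvgrPdist_le => r r0.
near=> k.
set prob := site_prob _ _.
have dk0 : 0 < (d k)%:R :> R by rewrite ltr0n.
have large : 1000 * (d k)%:R <= eps ^+ 2 * (n k)%:R.
  have : (d k)%:R <= eps ^+ 2 / 1000 * (n k)%:R.
    by near: k; apply: sparse; rewrite divr_gt0 ?exprn_gt0.
  lra.
have n0 : 0 < (n k)%:R :> R.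
  have : 0 < eps ^+ 2 * (n k)%:R by lra.
  by rewrite pmulr_rgt0 // exprn_gt0.
have := prob_long_path eps_bounds (d_gt0 k) (ndl k) (gap k) large.
rewrite -/prob => /andP[prob_ge prob_le1].
have error : 3000 / eps ^+ 4 * ((d k)%:R / (n k)%:R) <= r.
  have : (d k)%:R <= r * eps ^+ 4 / 3000 * (n k)%:R.
    by near: k; apply: sparse; rewrite divr_gt0 ?mulr_gt0 ?exprn_gt0.
  rewrite -ler_pdivrMr // => small.
  apply: le_trans (ler_wpM2l _ small) _; first by rewrite divr_ge0 ?exprn_ge0 // ltW.
  rewrite le_eqVlt; apply/orP; left; apply/eqP; field; rewrite gt_eqF //.
by rewrite ger0_norm ?subr_ge0 //; lra.
Unshelve. all: by end_near.
Qed.
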